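(* Fix an integer $m\ge1$. The function $\mathcal A(x)=C^{(m)}_0(e^x)$ satisfies $\mathcal A^{(m)}(x)=e^{mx}\mathcal A(x)$ (where $\mathcal A^{(m)}$ is the $m$-th derivative), and its Maclaurin coefficients, i.e. the numbers $S_m(n)$ in $\mathcal A(x)=\sum_{n\ge0}S_m(n)\frac{x^n}{n!}$, are $$S_m(n)=\sum_{k=0}^\infty\frac{(mk)^n}{(m^kk!)^m}$$ and satisfy $$S_m(n)=\sum_{r=0}^{m-1}B^{(m,r)}_n\,C^{(m)}_r(1)\qquad(n\ge0).$$
   Context: The convention $0^0=1$ is used. The hyper-Bessel carriers are $$C^{(m)}_0(x)=\sum_{k=0}^\infty\frac{(x/m)^{mk}}{(k!)^m},\qquad C^{(m)}_r(x)=\sum_{k=0}^\infty\frac{(x/m)^{mk+m-r}}{(k!)^r((k+1)!)^{m-r}}\quad(1\le r\le m-1).$$ For $0\le r<m$, the primitive $m$-Bell sequence $(B^{(m,r)}_n)_{n\ge0}$ is the unique solution of $a_{n+m}=\sum_{k=0}^n\binom nk m^{\,n-k}a_k$ $(n\ge0)$ with $B^{(m,r)}_n=\delta_{n,r}$ for $0\le n<m$. *)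

(* Defs.v *)
From Stdlib Require Import Reals Lra Lia Arith.
From Coquelicot Require Import Coquelicot.
Open Scope R_scope.

(** The [k]-th term of the series of the hyper-Bessel carrier [C^(m)_r]
    ([0 <= r < m]).  The case [r = 0] is not the instance [r = 0] of the general
    formula: the latter would shift the series by one index. *)
Definition carrier_term (m r : nat) (x : R) (k : nat) : R :=
  match r with
  | O => (x / INR m) ^ (m * k) / INR (fact k) ^ m
  | S _ => (x / INR m) ^ (m * k + m - r)
           / (INR (fact k) ^ r * INR (fact (k + 1)) ^ (m - r))
  end.

Definition carrier (m r : nat) (x : R) : R := Series (carrier_term m r x).

(** [Series] is a total operator; on the relevant parameters the carriers are
    sums of genuinely (absolutely) convergent series. *)
Lemma carrier_term_ex_series (m r : nat) (x : R) :
  (r < m)%nat -> ex_series (fun k => Rabs (carrier_term m r x k)).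
Proof.
intros Hr.
set (y := Rabs (x / INR m)).
set (s := match r with O => O | S _ => (m - r)%nat end).
assert (Hy : 0 <= y) by apply Rabs_pos.
assert (Hf : forall k, 1 <= INR (fact k)).
{ intros k. change 1 with (INR 1). apply le_INR. pose proof (lt_O_fact k). lia. }
assert (Hp : forall k n, 1 <= INR (fact k) ^ n).
{ intros k n. apply pow_R1_Rle, Hf. }
assert (Hq : forall k n, (1 <= n)%nat -> INR (fact k) <= INR (fact k) ^ n).
{ intros k n Hn. rewrite <- (pow_1 (INR (fact k))) at 1. now apply Rle_pow. }
apply (ex_series_le (V := R_CompleteNormedModule) _
         (fun k => y ^ s * (/ INR (fact k) * (y ^ m) ^ k))).
2:{ apply (ex_series_scal (K := R_AbsRing) (V := R_NormedModule) (y ^ s)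
             (fun k => / INR (fact k) * (y ^ m) ^ k)).
    exists (exp (y ^ m)).
    apply is_series_ext with (2 := is_exp_Reals (y ^ m)).
    intros n. rewrite pow_n_pow. apply Rmult_comm. }
intros k. change norm with Rabs. rewrite Rabs_Rabsolu.
assert (Hfk : 0 < INR (fact k)) by (specialize (Hf k); lra).
assert (Hgen : forall n d, (n = s + m * k)%nat -> INR (fact k) <= d ->
  Rabs ((x / INR m) ^ n / d) <= y ^ s * (/ INR (fact k) * (y ^ m) ^ k)).
{ intros n d -> Hd. unfold Rdiv at 1.
  rewrite Rabs_mult, <- RPow_abs, Rabs_inv, (Rabs_pos_eq d) by lra.
  fold y. rewrite pow_add, pow_mult, Rmult_assoc.
  apply Rmult_le_compat_l; [now apply pow_le|].
  rewrite Rmult_comm. apply Rmult_le_compat_r.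
  - now apply pow_le, pow_le.
  - now apply Rinv_le_contravar. }
unfold carrier_term, s in *. destruct r as [|r].
- apply Hgen; [lia | apply Hq; lia].
- apply Hgen; [lia|].
  pose proof (Hq k (S r) ltac:(lia)). pose proof (Hp (k + 1)%nat (m - S r)%nat).
  nra.
Qed.

(** [a] solves [a_{n+m} = sum_{k=0}^n binom(n,k) m^(n-k) a_k] with
    [a_n = delta_{n,r}] for [0 <= n < m]. *)
Definition is_primitive_mBell (m r : nat) (a : nat -> R) : Prop :=
  (forall n, (n < m)%nat -> a n = if Nat.eqb n r then 1 else 0) /\
  (forall n, a (n + m)%nat =
     sum_f_R0 (fun k => Binomial.C n k * INR m ^ (n - k) * a k) n).

(** Structural recursion on [fuel]; any [fuel > n] yields the same value when
    [1 <= m]. *)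
Fixpoint mBell_fuel (m r fuel n : nat) : R :=
  match fuel with
  | O => 0
  | S f =>
      if Nat.ltb n m then (if Nat.eqb n r then 1 else 0)
      else sum_f_R0 (fun k => Binomial.C (n - m) k * INR m ^ (n - m - k)
                              * mBell_fuel m r f k) (n - m)
  end.

Definition mBell (m r n : nat) : R := mBell_fuel m r (S n) n.

Lemma mBell_fuel_indep (m r : nat) : (1 <= m)%nat ->
  forall n f g, (n < f)%nat -> (n < g)%nat ->
  mBell_fuel m r f n = mBell_fuel m r g n.
Proof.
intros Hm n. induction n as [n IH] using lt_wf_ind. intros f g Hf Hg.
destruct f as [|f]; [lia|]. destruct g as [|g]; [lia|]. simpl.
destruct (Nat.ltb_spec n m) as [_|Hn]; [reflexivity|].
apply sum_eq. intros k Hk. f_equal. apply IH; lia.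
Qed.

Lemma mBell_spec (m r : nat) : (1 <= m)%nat -> is_primitive_mBell m r (mBell m r).
Proof.
intros Hm. split; intros n.
- intros Hn. unfold mBell. simpl. destruct (Nat.ltb_spec n m); [reflexivity|lia].
- unfold mBell at 1. cbn [mBell_fuel].
  destruct (Nat.ltb_spec (n + m) m) as [H|_]; [lia|].
  replace (n + m - m)%nat with n by lia.
  apply sum_eq. intros k Hk. f_equal. apply mBell_fuel_indep; lia.
Qed.

Lemma is_primitive_mBell_unique (m r : nat) (a b : nat -> R) : (1 <= m)%nat ->
  is_primitive_mBell m r a -> is_primitive_mBell m r b -> forall n, a n = b n.
Proof.
intros Hm [Ha0 Ha] [Hb0 Hb] n. induction n as [n IH] using lt_wf_ind.
destruct (Nat.lt_ge_cases n m) as [Hn|Hn].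
- now rewrite Ha0, Hb0.
- replace n with (n - m + m)%nat by lia. rewrite Ha, Hb.
  apply sum_eq. intros k Hk. f_equal. apply IH; lia.
Qed.

Definition calA (m : nat) (x : R) : R := carrier m 0 (exp x).

(** Exponential Maclaurin coefficients of [calA m]: the [S_m(n)] in
    [calA m x = sum_n S_m(n) x^n / n!]. *)
Definition maclaurinS (m n : nat) : R := Derive_n (calA m) n 0.

(* Main.v *)
Require Import Defs.
From Stdlib Require Import Reals Arith Lra Lia.
From Coquelicot Require Import Coquelicot.
Open Scope R_scope.

(** In the variable [y = exp (m * x)] the function [calA m] is the entire power
    series with coefficients [c k = 1 / (m ^ k * k!) ^ m]; equivalently it is the
    exponential sum of the [c k * exp (m * k * x)].  Differentiating in [x] is
    the Euler operator [m * y * d/dy], which multiplies the [k]-th coefficient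
    by [m * k].  So the [n]-th derivative has coefficients [(m * k) ^ n * c k]
    ([is_derive_n_PSeries_exp]), and at [x = 0], that is [y = 1], this is the
    formula for [maclaurinS m n] as a series.

    Everything arithmetic comes from the single identity
    [(m * (k + 1)) ^ m * c (k + 1) = c k] ([bessel_coef_succ]).  It says that
    [m] applications of the Euler operator amount to multiplication by [y], which
    is the differential equation.  Inserting it in the series for
    [maclaurinS m (n + m)] and expanding [(m * (k + 1)) ^ n] by the binomial
    formula gives the recurrence of the primitive [m]-Bell sequences
    ([maclaurinS_rec]).  The solutions of this recurrence are determined by their
    first [m] terms, so [maclaurinS m] is the combination of the sequences
    [mBell m r] with weights [maclaurinS m r], [r < m]; cancelling [k + 1] in the
    series turns these weights into [carrier m r 1] ([maclaurinS_init]).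

    The Maclaurin series converges to the function because
    [sum_k c k * exp (m * k * x)] may be expanded term by term: the error made by
    truncating each exponential after degree [N] is at most
    [(1/2) ^ N * exp (2 * |m * k * x|)] ([exp_truncation_error]), and the series
    with weights [exp (2 * |m * k * x|)] is again a value of the entire series. *)

(** * Exponential sums with entire coefficients *)

Definition euler_pow (c : R) (n : nat) (a : nat -> R) (k : nat) : R :=
  (c * INR k) ^ n * a k.

(** [PS_incr_1 (PS_derive _)] is [y * d/dy] on coefficients; routing through it
    gives access to the derivative and radius lemmas of power series. *)
Lemma euler_pow_S (c : R) (n : nat) (a : nat -> R) (k : nat) :
  PS_scal c (PS_incr_1 (PS_derive (euler_pow c n a))) k = euler_pow c (S n) a k.
Proof.
unfold PS_scal, PS_incr_1, PS_derive, euler_pow.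
change scal with Rmult.
destruct k as [|k].
- change zero with 0. simpl. ring.
- change (@eq R (c * (INR (S k) * ((c * INR (S k)) ^ n * a (S k))))
    ((c * INR (S k)) * (c * INR (S k)) ^ n * a (S k))).
  ring.
Qed.

Lemma CV_radius_euler_pow (c : R) (n : nat) (a : nat -> R) :
  c <> 0 -> CV_radius (euler_pow c n a) = CV_radius a.
Proof.
intros Hc. induction n as [|n IH].
- apply CV_radius_ext. intros k. unfold euler_pow. simpl. ring.
- rewrite <- (CV_radius_ext _ _ (euler_pow_S c n a)).
  now rewrite CV_radius_scal, CV_radius_incr_1, CV_radius_derive.
Qed.

Lemma ex_series_entire (a : nat -> R) (y : R) :
  CV_radius a = p_infty -> ex_series (fun k => Rabs (a k * y ^ k)).
Proof.
intros Ha. apply CV_disk_inside. now rewrite Ha.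
Qed.

Lemma is_derive_PSeries_exp (c x : R) (a : nat -> R) :
  CV_radius a = p_infty ->
  is_derive (fun t => PSeries a (exp (c * t))) x
    (PSeries (PS_scal c (PS_incr_1 (PS_derive a))) (exp (c * x))).
Proof.
intros Ha. rewrite PSeries_scal, PSeries_incr_1.
replace (c * (exp (c * x) * PSeries (PS_derive a) (exp (c * x))))
  with (scal (c * exp (c * x)) (PSeries (PS_derive a) (exp (c * x))))
  by (change scal with Rmult; simpl; ring).
apply (is_derive_comp (PSeries a) (fun t => exp (c * t))).
- apply is_derive_PSeries. now rewrite Ha.
- auto_derive; [exact I | ring].
Qed.

Lemma is_derive_n_PSeries_exp (c : R) (a : nat -> R) (n : nat) (x : R) :
  c <> 0 -> CV_radius a = p_infty ->
  is_derive_n (fun t => PSeries a (exp (c * t))) n x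
    (PSeries (euler_pow c n a) (exp (c * x))).
Proof.
intros Hc Ha. revert x. induction n as [|n IH]; intros x.
- simpl. apply PSeries_ext. intros k. unfold euler_pow. simpl. ring.
- simpl. rewrite <- (PSeries_ext _ _ _ (euler_pow_S c n a)).
  apply (is_derive_ext (fun t => PSeries (euler_pow c n a) (exp (c * t)))).
  + intros t. symmetry. now apply is_derive_n_unique.
  + apply is_derive_PSeries_exp. now rewrite CV_radius_euler_pow.
Qed.

(** * Term-by-term expansion of the exponentials *)

Lemma is_series_exp (t : R) : is_series (fun n => t ^ n / INR (fact n)) (exp t).
Proof.
apply is_series_ext with (2 := is_exp_Reals t).
intros n. rewrite pow_n_pow. reflexivity.
Qed.

(** Past degree [N] one has [|t| ^ n <= (1/2) ^ N * (2 * |t|) ^ n], so the tail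
    is at most [(1/2) ^ N] times the series of [exp (2 * |t|)].  The geometric
    factor is uniform in [t], which is what the summation over [k] in
    [is_series_maclaurin_PSeries_exp] requires. *)
Lemma exp_truncation_error (t : R) (N : nat) :
  Rabs (exp t - sum_f_R0 (fun n => t ^ n / INR (fact n)) N)
  <= (1 / 2) ^ N * exp (2 * Rabs t).
Proof.
set (f := fun n => t ^ n / INR (fact n)).
set (h := fun n => (2 * Rabs t) ^ n / INR (fact n)).
assert (Hf : ex_series f) by (exists (exp t); apply is_series_exp).
assert (Hh : ex_series h) by (exists (exp (2 * Rabs t)); apply is_series_exp).
assert (Hpos : forall n, 0 <= h n).
{ intros n. apply Rdiv_le_0_compat; [|apply INR_fact_lt_0].
  apply pow_le. pose proof (Rabs_pos t). lra. }
assert (Htail : ex_series (fun k => h (S N + k)%nat))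
  by now apply (ex_series_incr_n h (S N)).
assert (Hle : forall k, 0 <= Rabs (f (S N + k)%nat) <= (1 / 2) ^ N * h (S N + k)%nat).
{ intros k. split; [apply Rabs_pos|]. unfold f, h, Rdiv.
  rewrite Rabs_mult, <- RPow_abs, Rabs_inv,
    (Rabs_pos_eq (INR _)) by apply pos_INR.
  rewrite <- Rmult_assoc. apply Rmult_le_compat_r.
  { left. apply Rinv_0_lt_compat, INR_fact_lt_0. }
  assert (H2 : (1 * / 2) ^ N * 2 ^ (S N + k) = 2 ^ S k).
  { replace (S N + k)%nat with (N + S k)%nat by lia.
    rewrite pow_add, <- Rmult_assoc, <- Rpow_mult_distr.
    replace (1 * / 2 * 2) with 1 by field. rewrite pow1. ring. }
  rewrite (Rpow_mult_distr 2), <- Rmult_assoc, H2.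
  rewrite <- (Rmult_1_l (Rabs t ^ _)) at 1.
  apply Rmult_le_compat_r; [apply pow_le, Rabs_pos | apply pow_R1_Rle; lra]. }
rewrite <- (is_series_unique _ _ (is_series_exp t)).
rewrite <- (is_series_unique _ _ (is_series_exp (2 * Rabs t))).
fold f. fold h.
rewrite (Series_incr_n f (S N)), (Series_incr_n h (S N)) by (lia || assumption).
simpl Init.Nat.pred.
match goal with |- Rabs ?u <= _ =>
  replace u with (Series (fun k => f (S N + k)%nat)) by ring end.
assert (Hex : ex_series (fun k => (1 / 2) ^ N * h (S N + k)%nat))
  by now apply (ex_series_scal (V := R_NormedModule)).
eapply Rle_trans.
{ apply Series_Rabs.
  apply (ex_series_le (V := R_CompleteNormedModule)) with (2 := Hex).
  intros k. change norm with Rabs. rewrite Rabs_Rabsolu. apply Hle. }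
eapply Rle_trans; [exact (Series_le _ _ Hle Hex)|].
rewrite Series_scal_l. apply Rmult_le_compat_l; [apply pow_le; lra|].
assert (0 <= sum_f_R0 h N) by now apply cond_pos_sum.
lra.
Qed.

Lemma is_series_sum_f_R0 (u : nat -> nat -> R) (l : nat -> R) (N : nat) :
  (forall j, is_series (u j) (l j)) ->
  is_series (fun k => sum_f_R0 (fun j => u j k) N) (sum_f_R0 l N).
Proof.
intros H. induction N as [|N IH]; simpl; [apply H|].
exact (is_series_plus _ _ _ _ IH (H (S N))).
Qed.

Lemma exp_mult_INR (u : R) (k : nat) : exp (u * INR k) = exp u ^ k.
Proof.
induction k as [|k IH].
- simpl. now rewrite Rmult_0_r, exp_0.
- rewrite S_INR, Rmult_plus_distr_l, Rmult_1_r, exp_plus, IH. simpl. ring.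
Qed.

Lemma is_series_euler_pow (c : R) (n : nat) (a : nat -> R) :
  c <> 0 -> CV_radius a = p_infty ->
  is_series (euler_pow c n a) (PSeries (euler_pow c n a) 1).
Proof.
intros Hc Ha.
apply is_series_ext with (fun k => euler_pow c n a k * 1 ^ k).
{ intros k. rewrite pow1. apply Rmult_1_r. }
apply Series_correct, ex_series_Rabs, ex_series_entire.
now rewrite CV_radius_euler_pow.
Qed.

Lemma is_series_maclaurin_PSeries_exp (c : R) (a : nat -> R) (x : R) :
  c <> 0 -> CV_radius a = p_infty ->
  is_series (fun n => PSeries (euler_pow c n a) 1 * (x ^ n / INR (fact n)))
    (PSeries a (exp (c * x))).
Proof.
intros Hc Ha.
set (s := fun n => PSeries (euler_pow c n a) 1 * (x ^ n / INR (fact n))).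
set (E := exp (2 * Rabs (c * x))).
set (K := Series (fun k => Rabs (a k * E ^ k))).
assert (HK : ex_series (fun k => Rabs (a k * E ^ k))) by now apply ex_series_entire.
assert (Herr : forall N,
  Rabs (PSeries a (exp (c * x)) - sum_f_R0 s N) <= (1 / 2) ^ N * K).
{ intros N.
  set (d := fun k => a k *
    (exp (c * x * INR k)
     - sum_f_R0 (fun n => (c * x * INR k) ^ n / INR (fact n)) N)).
  assert (Hd : is_series d (PSeries a (exp (c * x)) - sum_f_R0 s N)).
  { apply is_series_ext with (fun k => minus (a k * exp (c * x) ^ k)
      (sum_f_R0 (fun n => euler_pow c n a k * (x ^ n / INR (fact n))) N)).
    { intros k. change minus with Rminus. unfold d.
      rewrite Rmult_minus_distr_l, exp_mult_INR, scal_sum. f_equal.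
      apply sum_eq. intros n _. unfold euler_pow.
      rewrite !Rpow_mult_distr. unfold Rdiv. ring. }
    apply (is_series_minus (V := R_NormedModule)).
    - apply Series_correct, ex_series_Rabs. now apply ex_series_entire.
    - apply (is_series_sum_f_R0
        (fun n k => euler_pow c n a k * (x ^ n / INR (fact n)))).
      intros n. apply is_series_scal_r. now apply is_series_euler_pow. }
  assert (Hb : forall k, 0 <= Rabs (d k) <= (1 / 2) ^ N * Rabs (a k * E ^ k)).
  { intros k. split; [apply Rabs_pos|]. unfold d. rewrite !Rabs_mult.
    replace ((1 / 2) ^ N * (Rabs (a k) * Rabs (E ^ k)))
      with (Rabs (a k) * ((1 / 2) ^ N * exp (2 * Rabs (c * x * INR k)))).
    { apply Rmult_le_compat_l; [apply Rabs_pos|]. apply exp_truncation_error. }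
    rewrite (Rabs_pos_eq (E ^ k)) by (apply pow_le; left; apply exp_pos).
    rewrite (Rabs_mult (c * x)), (Rabs_pos_eq (INR k)) by apply pos_INR.
    rewrite <- (Rmult_assoc 2), (exp_mult_INR (2 * Rabs (c * x))).
    fold E. ring. }
  assert (Hex : ex_series (fun k => (1 / 2) ^ N * Rabs (a k * E ^ k)))
    by now apply (ex_series_scal (V := R_NormedModule)).
  rewrite <- (is_series_unique _ _ Hd).
  eapply Rle_trans.
  { apply Series_Rabs.
    apply (ex_series_le (V := R_CompleteNormedModule)) with (2 := Hex).
    intros k. change norm with Rabs. rewrite Rabs_Rabsolu. apply Hb. }
  eapply Rle_trans; [exact (Series_le _ _ Hb Hex)|].
  rewrite Series_scal_l. apply Rle_refl. }
assert (Hgeom : is_lim_seq (fun N => (1 / 2) ^ N * K) 0).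
{ replace 0 with (0 * K) by ring.
  apply (is_lim_seq_scal_r (fun N => (1 / 2) ^ N) K 0), is_lim_seq_geom.
  rewrite Rabs_pos_eq; lra. }
set (A := PSeries a (exp (c * x))) in *.
change (is_lim_seq (sum_n s) A).
apply is_lim_seq_le_le with
  (u := fun N => A - (1 / 2) ^ N * K) (w := fun N => A + (1 / 2) ^ N * K).
- intros N. rewrite sum_n_Reals. specialize (Herr N).
  apply Rabs_le_between in Herr. lra.
- replace (Finite A) with (Finite (A - 0)) by (f_equal; ring).
  apply is_lim_seq_minus' with (2 := Hgeom). apply is_lim_seq_const.
- replace (Finite A) with (Finite (A + 0)) by (f_equal; ring).
  apply is_lim_seq_plus' with (2 := Hgeom). apply is_lim_seq_const.
Qed.

(** * The hyper-Bessel coefficients *)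

Definition bessel_coef (m k : nat) : R := / (INR m ^ k * INR (fact k)) ^ m.

Lemma INR_ge1_neq0 (m : nat) : (1 <= m)%nat -> INR m <> 0.
Proof. intros Hm. apply not_0_INR. lia. Qed.

Lemma bessel_coef_den_neq0 (m k : nat) :
  (1 <= m)%nat -> INR m ^ k * INR (fact k) <> 0.
Proof.
intros Hm. apply Rmult_integral_contrapositive_currified.
- now apply pow_nonzero, INR_ge1_neq0.
- apply INR_fact_neq_0.
Qed.

Lemma bessel_coef_succ (m k : nat) : (1 <= m)%nat ->
  (INR m * INR (S k)) ^ m * bessel_coef m (S k) = bessel_coef m k.
Proof.
intros Hm. unfold bessel_coef.
rewrite <- !pow_inv, <- Rpow_mult_distr. f_equal.
rewrite fact_simpl, mult_INR. change (INR m ^ S k) with (INR m * INR m ^ k).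
pose proof (INR_ge1_neq0 m Hm). pose proof (INR_fact_neq_0 k).
pose proof (pow_nonzero _ k H). pose proof (INR_ge1_neq0 (S k) ltac:(lia)).
field. auto.
Qed.

(** Ratio test: by [bessel_coef_succ] the ratio of consecutive coefficients is
    [1 / (m * (k + 1)) ^ m <= 1 / (k + 1)]. *)
Lemma CV_radius_bessel_coef (m : nat) :
  (1 <= m)%nat -> CV_radius (bessel_coef m) = p_infty.
Proof.
intros Hm. apply CV_radius_infinite_DAlembert.
{ intros k. apply Rinv_neq_0_compat, pow_nonzero. now apply bessel_coef_den_neq0. }
apply is_lim_seq_le_le with (u := fun _ => 0) (w := fun k => / INR (S k)).
- intros k. split; [apply Rabs_pos|].
  rewrite <- (bessel_coef_succ m k Hm).
  assert (Hc : bessel_coef m (S k) <> 0).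
  { apply Rinv_neq_0_compat, pow_nonzero. now apply bessel_coef_den_neq0. }
  assert (Hmk : 1 <= INR m * INR (S k)).
  { rewrite <- mult_INR. apply (le_INR 1). nia. }
  assert (HSk : 0 < INR (S k)) by (apply lt_0_INR; lia).
  assert (Hp : INR (S k) <= (INR m * INR (S k)) ^ m).
  { apply Rle_trans with ((INR m * INR (S k)) ^ 1); [|now apply Rle_pow].
    rewrite pow_1. pose proof (le_INR 1 m Hm) as H1. simpl in H1. nra. }
  replace (bessel_coef m (S k) / ((INR m * INR (S k)) ^ m * bessel_coef m (S k)))
    with (/ (INR m * INR (S k)) ^ m) by (field; split; lra).
  rewrite Rabs_pos_eq.
  + apply Rinv_le_contravar; lra.
  + left. apply Rinv_0_lt_compat. lra.
- apply is_lim_seq_const.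
- change (Finite 0) with (Rbar_inv p_infty). apply is_lim_seq_inv.
  + apply (is_lim_seq_incr_1 INR), is_lim_seq_INR.
  + discriminate.
Qed.

Lemma calA_PSeries (m : nat) (x : R) : (1 <= m)%nat ->
  calA m x = PSeries (bessel_coef m) (exp (INR m * x)).
Proof.
intros Hm. unfold calA, carrier, PSeries. apply Series_ext. intros k.
unfold carrier_term, bessel_coef.
rewrite (Rmult_comm (INR m) x), exp_mult_INR, <- !pow_mult, Rpow_mult_distr, <- pow_mult.
unfold Rdiv. rewrite Rpow_mult_distr, pow_inv, (Nat.mul_comm k m).
rewrite Rinv_mult. ring.
Qed.

(** * Derivatives and Maclaurin coefficients *)

Lemma is_derive_n_calA (m n : nat) (x : R) : (1 <= m)%nat ->
  is_derive_n (calA m) n x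
    (PSeries (euler_pow (INR m) n (bessel_coef m)) (exp (INR m * x))).
Proof.
intros Hm.
apply is_derive_n_ext with (fun t => PSeries (bessel_coef m) (exp (INR m * t))).
{ intros t. symmetry. now apply calA_PSeries. }
apply is_derive_n_PSeries_exp.
- now apply INR_ge1_neq0.
- now apply CV_radius_bessel_coef.
Qed.

Lemma PSeries_euler_pow_bessel_coef (m : nat) (y : R) : (1 <= m)%nat ->
  PSeries (euler_pow (INR m) m (bessel_coef m)) y = y * PSeries (bessel_coef m) y.
Proof.
intros Hm. rewrite <- PSeries_incr_1. apply PSeries_ext. intros [|k].
- unfold euler_pow. simpl. rewrite Rmult_0_r, pow_i by lia. apply Rmult_0_l.
- now apply bessel_coef_succ.
Qed.

Lemma maclaurinS_PSeries (m n : nat) : (1 <= m)%nat ->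
  maclaurinS m n = PSeries (euler_pow (INR m) n (bessel_coef m)) 1.
Proof.
intros Hm. unfold maclaurinS.
rewrite (is_derive_n_unique _ _ _ _ (is_derive_n_calA m n 0 Hm)).
now rewrite Rmult_0_r, exp_0.
Qed.

Lemma is_series_maclaurinS (m n : nat) : (1 <= m)%nat ->
  is_series (euler_pow (INR m) n (bessel_coef m)) (maclaurinS m n).
Proof.
intros Hm. rewrite maclaurinS_PSeries by easy. apply is_series_euler_pow.
- now apply INR_ge1_neq0.
- now apply CV_radius_bessel_coef.
Qed.

(** * The Bell recurrence *)

(** The term at [k = 0] vanishes as soon as [0 < n], by [0 ^ n = 0]; dropping it
    is the index shift that makes [bessel_coef_succ] applicable. *)
Lemma is_series_maclaurinS_shift (m n : nat) : (1 <= m)%nat -> (0 < n)%nat ->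
  is_series (fun k => euler_pow (INR m) n (bessel_coef m) (S k)) (maclaurinS m n).
Proof.
intros Hm Hn. apply is_series_incr_1.
replace (plus _ _) with (maclaurinS m n); [now apply is_series_maclaurinS|].
change plus with Rplus. unfold euler_pow. simpl INR.
rewrite Rmult_0_r, pow_i by easy. simpl. ring.
Qed.

Lemma maclaurinS_rec (m n : nat) : (1 <= m)%nat ->
  maclaurinS m (n + m) =
  sum_f_R0 (fun j => Binomial.C n j * INR m ^ (n - j) * maclaurinS m j) n.
Proof.
intros Hm.
rewrite <- (is_series_unique _ _ (is_series_maclaurinS_shift m (n + m) Hm ltac:(lia))).
apply is_series_unique.
apply is_series_ext with (fun k => sum_f_R0 (fun j =>
  Binomial.C n j * INR m ^ (n - j) * euler_pow (INR m) j (bessel_coef m) k) n).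
{ intros k. unfold euler_pow.
  rewrite pow_add, Rmult_assoc, bessel_coef_succ by easy.
  rewrite S_INR, Rmult_plus_distr_l, Rmult_1_r, binomial,
    (Rmult_comm (sum_f_R0 _ _)), scal_sum.
  apply sum_eq. intros j _. ring. }
apply (is_series_sum_f_R0 (fun j k =>
  Binomial.C n j * INR m ^ (n - j) * euler_pow (INR m) j (bessel_coef m) k)).
intros j. apply (is_series_scal_l (V := R_NormedModule)).
now apply is_series_maclaurinS.
Qed.

(** The case [r = 0] is the value of [calA m] at [0].  For [0 < r] the [k]-th
    term of [carrier m r 1] is the term of index [k + 1] of the series for
    [maclaurinS m r], with [(k + 1) ^ r] cancelled against [r] of the [m]
    factors [(k + 1)!]. *)
Lemma maclaurinS_init (m r : nat) : (r < m)%nat -> maclaurinS m r = carrier m r 1.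
Proof.
intros Hr. assert (Hm : (1 <= m)%nat) by lia.
assert (HM := INR_ge1_neq0 m Hm).
symmetry. destruct r as [|r].
- change (maclaurinS m 0) with (carrier m 0 (exp 0)). now rewrite exp_0.
- apply is_series_unique.
  apply is_series_ext with (2 := is_series_maclaurinS_shift m (S r) Hm ltac:(lia)).
  intros k. unfold carrier_term, euler_pow, bessel_coef.
  set (p := S r) in *. clearbody p.
  replace (m * k + m - p)%nat with (m * k + (m - p))%nat by lia.
  rewrite pow_add, pow_mult, (Nat.add_1_r k), fact_simpl, mult_INR.
  replace ((INR m ^ S k * (INR (S k) * INR (fact k))) ^ m)
    with ((INR m ^ m) ^ k * (INR m * INR (S k) * INR (fact k)) ^ p
          * (INR m * (INR (S k) * INR (fact k))) ^ (m - p)).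
  + rewrite !Rpow_mult_distr. unfold Rdiv. rewrite Rmult_1_l, !pow_inv.
    pose proof (INR_ge1_neq0 (S k) ltac:(lia)) as HS.
    pose proof (INR_fact_neq_0 k) as HF.
    match goal with |- ?u = ?v => change (@eq R u v) end.
    field. repeat split; auto using pow_nonzero.
  + rewrite <- !Rmult_assoc, (Rmult_assoc (_ ^ k)), <- pow_add.
    replace (p + (m - p))%nat with m by lia.
    rewrite <- pow_mult, (Nat.mul_comm m k), pow_mult, <- Rpow_mult_distr.
    f_equal. simpl pow. ring.
Qed.

Lemma sum_f_R0_indicator (u : nat -> R) (n N : nat) : (n <= N)%nat ->
  sum_f_R0 (fun r => (if Nat.eqb n r then 1 else 0) * u r) N = u n.
Proof.
intros Hn. induction N as [|N IH]; simpl.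
- replace n with O by lia. simpl. ring.
- destruct (Nat.eqb_spec n (S N)) as [->|Hne].
  + rewrite (sum_eq _ (fun _ => 0)), sum_eq_R0; [ring | easy |].
    intros r Hr. destruct (Nat.eqb_spec (S N) r); [lia | ring].
  + rewrite IH by lia. ring.
Qed.

Lemma maclaurinS_mBell (m n : nat) : (1 <= m)%nat ->
  maclaurinS m n = sum_f_R0 (fun r => mBell m r n * carrier m r 1) (m - 1).
Proof.
intros Hm. induction n as [n IH] using lt_wf_ind.
destruct (Nat.lt_ge_cases n m) as [Hn|Hn].
- rewrite (sum_eq _ (fun r => (if Nat.eqb n r then 1 else 0) * carrier m r 1)).
  + rewrite sum_f_R0_indicator by lia. now apply maclaurinS_init.
  + intros r _. now rewrite (proj1 (mBell_spec m r Hm)).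
- replace n with (n - m + m)%nat by lia. rewrite maclaurinS_rec by easy.
  set (N := (n - m)%nat).
  rewrite (sum_eq _ (fun j => sum_f_R0 (fun r =>
    Binomial.C N j * INR m ^ (N - j) * mBell m r j * carrier m r 1) (m - 1))).
  2:{ intros j Hj. rewrite (IH j) by lia. rewrite scal_sum.
      apply sum_eq. intros r _. ring. }
  rewrite <- sum_n_Reals.
  rewrite (sum_n_ext _ (fun j => sum_n (fun r =>
    Binomial.C N j * INR m ^ (N - j) * mBell m r j * carrier m r 1) (m - 1)))
    by (intros j; now rewrite sum_n_Reals).
  rewrite sum_n_switch, sum_n_Reals.
  apply sum_eq. intros r _. rewrite (proj2 (mBell_spec m r Hm)), sum_n_Reals.
  rewrite Rmult_comm, scal_sum. reflexivity.
Qed.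

Theorem theorem7p8 (m : nat) (hm : (1 <= m)%nat) :
  (forall (n : nat) (x : R), ex_derive_n (calA m) n x) /\
  (forall x : R, is_derive_n (calA m) m x (exp (INR m * x) * calA m x)) /\
  (forall x : R,
     is_series (fun n => maclaurinS m n * (x ^ n / INR (fact n))) (calA m x)) /\
  (forall n : nat,
     is_series (fun k => (INR m * INR k) ^ n / (INR m ^ k * INR (fact k)) ^ m)
               (maclaurinS m n)) /\
  (forall n : nat,
     maclaurinS m n = sum_f_R0 (fun r => mBell m r n * carrier m r 1) (m - 1)).
Proof.
repeat split.
- intros [|n] x; [exact I|]. eexists. exact (is_derive_n_calA m (S n) x hm).
- intros x. rewrite calA_PSeries, <- PSeries_euler_pow_bessel_coef by easy.
  now apply is_derive_n_calA.
- intros x. rewrite calA_PSeries by easy.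
  apply is_series_ext with (2 := is_series_maclaurin_PSeries_exp (INR m)
    (bessel_coef m) x (INR_ge1_neq0 m hm) (CV_radius_bessel_coef m hm)).
  intros n. now rewrite maclaurinS_PSeries.
- intros n. now apply is_series_maclaurinS.
- intros n. now apply maclaurinS_mBell.
Qed.
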